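(* Let $d_1,d_2$ be nonnegative real numbers with $d_1<1$. The probability that a random formula from $H^2_{n,d_1,d_2}$ is satisfiable in the limit $n\to\infty$ is $$\Phi(d_1,d_2) := \lim_{n\to\infty} \Pr\left[H^2_{n,d_1,d_2} \text{ is satisfiable}\right] = -\frac{W\left(-(1-d_1)\,d_2\,e^{-d_2}\right)}{(1-d_1)\,d_2},$$ where $W(\cdot)$ is Lambert's function, defined as the principal root of the equation $W(x)e^{W(x)}=x$.
   Context: A Horn clause is a disjunction of literals of which at most one is positive; a Horn-SAT formula is a conjunction of Horn clauses. For nonnegative real numbers $d_1,d_2$ with $d_1<1$, the random Horn-SAT formula $H^2_{n,d_1,d_2}$ on Boolean variables $x_1,\ldots,x_n$ is the conjunction of: (1) a single negative literal $\overline{x}_1$; (2) $d_1 n$ positive literals chosen uniformly without replacement from $x_2,\ldots,x_n$; and (3) $d_2 n$ clauses chosen uniformly from the $2\binom{n}{2}$ possible Horn clauses with $2$ variables where one literal is positive.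
   Formalization: The case d_1 = 0 with d_2 > 1 is excluded, since there the formula is always satisfiable (limit 1) while the Lambert expression is below 1; at d_2 = 0, where the quotient is 0/0, Φ is taken to be its continuous extension 1. *)

(* Defs.v *)
From HB Require Import structures.
From mathcomp Require Import all_boot all_order all_algebra.
From mathcomp Require Import all_classical all_reals all_analysis.

Set Implicit Arguments.
Unset Strict Implicit.
Unset Printing Implicit Defensive.

Import Order.TTheory GRing.Theory Num.Theory.
Import numFieldNormedType.Exports.

Local Open Scope set_scope.
Local Open Scope ring_scope.

(* The literal (b, i) is the variable i if b = true, and its negation if
   b = false. A clause is the disjunction of its literals, a formula the
   conjunction of its clauses. *)
Definition literal (n : nat) := (bool * 'I_n)%type.
Definition clause (n : nat) := {set literal n}.
Definition formula (n : nat) := seq (clause n).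

Definition is_horn_clause (n : nat) (C : clause n) : bool :=
  (#|[set l in C | l.1]| <= 1)%N.

Definition is_horn_formula (n : nat) (F : formula n) : bool :=
  all (@is_horn_clause n) F.

Definition sat_clause (n : nat) (a : {ffun 'I_n -> bool}) (C : clause n) :
    bool :=
  [exists l in C, a l.2 == l.1].

Definition satisfiable (n : nat) (F : formula n) : bool :=
  [exists a : {ffun 'I_n -> bool}, all (sat_clause a) F].

Definition binary_horn_clauses (n : nat) : {set clause n} :=
  [set C | [exists i, exists j,
    (i != j) && (C == [set (true, i); (false, j)])]].

(* There are n.+1 variables, so that the first one, ord0, always exists.
   An outcome is the set of the k1 variables occurring as positive unit
   clauses (a sample without replacement from the variables other than ord0)
   and the sequence of the k2 binary clauses (independent draws, so that
   repetitions are allowed). *)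
Definition horn_outcomes (n k1 k2 : nat) :
    {set {set 'I_n.+1} * k2.-tuple (clause n.+1)} :=
  [set w : {set 'I_n.+1} * k2.-tuple (clause n.+1) |
    [&& w.1 \subset [set~ ord0], #|w.1| == k1 &
        all (mem (binary_horn_clauses n.+1)) w.2]].

Definition horn_formula (n k2 : nat)
    (w : {set 'I_n.+1} * k2.-tuple (clause n.+1)) : formula n.+1 :=
  [set (false, ord0)] :: [seq [set (true, i)] | i <- enum w.1] ++ w.2.

Definition finite_uniform_prob (R : realType) (T : finType) (S : {set T})
    (E : pred T) : R :=
  #|[set x in S | E x]|%:R / #|S|%:R.

(* The probability that the random formula with n.+1 variables is satisfiable;
   the numbers of clauses are rounded down. *)
Definition horn_sat_prob (R : realType) (d1 d2 : R) (n : nat) : R :=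
  let k1 := Num.truncn (d1 * n.+1%:R) in
  let k2 := Num.truncn (d2 * n.+1%:R) in
  finite_uniform_prob R (horn_outcomes n k1 k2) (fun w => satisfiable (horn_formula w)).

(* The principal real branch: the root w >= -1, which exists and is unique when
   - expR (-1) <= x. Outside this domain the value is the default 0. *)
Definition lambertW (R : realType) (x : R) : R :=
  xget 0 [set w : R | -1 <= w /\ w * expR w = x]%classic.

(* The quotient is 0 / 0 at d2 = 0, where its continuous extension is 1.
   At d1 = 0 with d2 > 1, Phi is not the probability of satisfiability: without
   positive literals the all-false assignment satisfies the formula, while
   Phi 0 d2 < 1. *)
Definition Phi (R : realType) (d1 d2 : R) : R :=
  if d2 == 0 then 1
  else - lambertW (- ((1 - d1) * d2 * expR (- d2))) / ((1 - d1) * d2).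

Lemma card_binary_horn_clauses (n : nat) :
  #|binary_horn_clauses n| = (2 * 'C(n, 2))%N.
Proof.
have inj : injective (fun p : 'I_n * 'I_n => [set (true, p.1); (false, p.2)]).
  move=> [i j] [i' j'] /= /setP e.
  have := e (true, i); rewrite !inE !xpair_eqE !eqxx /= orbF => /esym/eqP->.
  by have := e (false, j); rewrite !inE !xpair_eqE !eqxx /= => /esym/eqP->.
have -> : binary_horn_clauses n =
    (fun p : 'I_n * 'I_n => [set (true, p.1); (false, p.2)])
      @: [pred p | p.1 != p.2].
  apply/setP => C; rewrite inE; apply/fintype.existsP/imsetP.
    by case=> i /fintype.existsP[j /andP[ij /eqP->]]; exists (i, j).
  case=> -[i j] ij ->; exists i; apply/fintype.existsP; exists j.
  by rewrite eqxx andbT.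
rewrite card_imset //; have := cardC [pred p : 'I_n * 'I_n | p.1 == p.2].
rewrite card_prod card_ord.
have -> : #|[pred p : 'I_n * 'I_n | p.1 == p.2]| = n.
  rewrite -[RHS]card_ord -(card_imset _ (f := fun i : 'I_n => (i, i))).
    apply: eq_card => -[i j]; rewrite !inE /=; apply/eqP/imsetP => [->|].
      by exists j.
    by case=> k _ [-> ->].
  by move=> i j [].
move=> e; rewrite mul2n bin2 halfK oddM; case: n e {inj} => [|n] /=.
  by move/eqP; rewrite addn_eq0 => /andP[_ /eqP].
by rewrite andNb subn0 mulSn => /addnI e; rewrite mulnC -e; apply: eq_card.
Qed.

Lemma horn_formula_is_horn (n k1 k2 : nat)
    (w : {set 'I_n.+1} * k2.-tuple (clause n.+1)) :
  w \in horn_outcomes n k1 k2 -> is_horn_formula (horn_formula w).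
Proof.
rewrite inE => /and3P[_ _ /allP w2].
have le1 (C : clause n.+1) (l : literal n.+1) :
    (forall l' : literal n.+1, l' \in C -> l'.1 -> l' = l) ->
    is_horn_clause C.
  move=> h; rewrite /is_horn_clause -(cards1 l).
  apply/subset_leq_card/fintype.subsetP => l'.
  by rewrite !inE => /andP[/h/[apply] ->]; rewrite eqxx.
apply/allP => C; rewrite inE mem_cat => /or3P[/eqP->|/mapP[i _ ->]|/w2].
- by apply: (le1 _ (false, ord0)) => l'; rewrite inE => /eqP->.
- by apply: (le1 _ (true, i)) => l'; rewrite inE => /eqP->.
rewrite !inE => /fintype.existsP[i /fintype.existsP[j /andP[_ /eqP->]]].
apply: (le1 _ (true, i)) => l'.
by rewrite !inE => /orP[] /eqP->.
Qed.

(* Main.v *)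
(* A clause [v \/ ~ u] is an arc [(u, v)], and the formula is unsatisfiable iff
   some unit variable is an ancestor of the first variable. Let [A] be the set
   of ancestors of the first variable and let [0 < d1] (if [d1 = 0], then the
   formula is always satisfiable). Given [#|A| = k + 1], the probability that
   the unit variables avoid [A] tends to [(1 - d1) ^ k], and it decays
   geometrically in [k], so large [A] do not matter.
   For fixed [k] the probability that [#|A| = k + 1] tends to
   [c k * d2 ^ k * expR (- d2 * (k + 1))], where [c k] counts the trees spanning
   [A] and does not depend on [d2]. For densities [d < 1] the expectation of
   [#|A|] is at most [1 / (1 - d)], so these limits sum to 1, that is,
   [\sum_k c k * (d * expR (- d)) ^ k = expR d]. Choosing [w] in [0, 1) with
   [w * expR (- w) = (1 - d1) * d2 * expR (- d2)], the limit of the probability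
   of satisfiability is [expR (w - d2)], and [w] is minus the value of Lambert's
   function. *)
Require Import Defs.
From mathcomp Require Import all_boot.

Set Implicit Arguments.
Unset Strict Implicit.
Unset Printing Implicit Defensive.

Local Open Scope set_scope.

(** * Sums over sequences *)

(** Recursion on the length keeps [F] on plain sequences, so filtering, mapping and prepending need
    no tuples. For a boolean [F] it counts sequences. *)
Fixpoint lsum (T : finType) (X : {set T}) (m : nat) (F : seq T -> nat) : nat :=
  if m is m'.+1 then \sum_(x in X) lsum X m' (fun t => F (x :: t)) else F [::].

(** Serves the induction in [lsum_split]: by Pascal's rule, the two summands account for a first
    entry counted by [a] and for one among [y] free choices. *)
Lemma pascal_sum (a : nat -> nat) (y m : nat) :
  \sum_(j < m.+2) 'C(m.+1, j) * a j * y ^ (m.+1 - j) =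
  \sum_(j < m.+1) 'C(m, j) * a j.+1 * y ^ (m - j) +
  y * \sum_(j < m.+1) 'C(m, j) * a j * y ^ (m - j).
Proof.
rewrite big_ord_recl /= !bin0 !mul1n subn0.
under eq_bigr do rewrite /bump /= add1n binS subSS !mulnDl.
rewrite big_split /= addnA addnC; congr (_ + _).
rewrite big_ord_recr /= bin_small // !mul0n addn0.
rewrite [in RHS]big_ord_recl /= bin0 mul1n subn0 mulnDr.
congr (_ + _); first by rewrite expnS mulnCA.
rewrite big_distrr /=; apply: eq_bigr => j _.
by rewrite /bump /= add1n mulnCA -expnS subnSK.
Qed.

Section Lsum.
Variables (T : finType) (X : {set T}).

Lemma eq_in_lsum (m : nat) (F G : seq T -> nat) :
  (forall t, size t = m -> all (mem X) t -> F t = G t) ->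
  lsum X m F = lsum X m G.
Proof.
elim: m F G => [|m IH] F G FG /=; first exact: FG.
apply: eq_bigr => x xX; apply: IH => t tm tX; apply: FG; rewrite /= ?tm //.
by apply/andP; split.
Qed.

Lemma leq_lsum (m : nat) (F G : seq T -> nat) :
  (forall t, size t = m -> all (mem X) t -> F t <= G t) ->
  lsum X m F <= lsum X m G.
Proof.
elim: m F G => [|m IH] F G FG /=; first exact: FG.
apply: leq_sum => x xX; apply: IH => t tm tX; apply: FG; rewrite /= ?tm //.
by apply/andP; split.
Qed.

Lemma lsumD (m : nat) (F G : seq T -> nat) :
  lsum X m (fun t => F t + G t) = lsum X m F + lsum X m G.
Proof.
elim: m F G => [|m IH] F G //=.
by rewrite -big_split /=; apply: eq_bigr => x _; rewrite IH.
Qed.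

Lemma lsum_sum (I : finType) (P : pred I) (m : nat) (F : I -> seq T -> nat) :
  lsum X m (fun t => \sum_(i | P i) F i t) = \sum_(i | P i) lsum X m (F i).
Proof.
elim: m F => [|m IH] F //=.
by rewrite exchange_big; apply: eq_bigr => x _; rewrite IH.
Qed.

Lemma lsumMl (c m : nat) (F : seq T -> nat) :
  lsum X m (fun t => c * F t) = c * lsum X m F.
Proof.
elim: m F => [|m IH] F //=.
by rewrite big_distrr /=; apply: eq_bigr => x _; rewrite IH.
Qed.

Lemma lsum_const (c m : nat) : lsum X m (fun=> c) = #|X| ^ m * c.
Proof.
elim: m => [|m IH] /=; first by rewrite expn0 mul1n.
by rewrite sum_nat_const IH expnS mulnA.
Qed.

Lemma sum_tuple_lsum (m : nat) (F : seq T -> nat) :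
  \sum_(t : m.-tuple T | all (mem X) t) F t = lsum X m F.
Proof.
elim: m F => [|m IH] F /=.
  rewrite (big_pred1 [tuple]) // => t.
  by rewrite (tuple0 t) /= eqxx.
under [RHS]eq_bigr do rewrite -IH.
rewrite pair_big_dep /=.
rewrite (reindex (fun p : T * m.-tuple T => [tuple of p.1 :: p.2])) //=.
exists (fun t : m.+1.-tuple T => (thead t, [tuple of behead t])).
  by case=> x t _; rewrite theadE; congr pair; apply/val_inj.
by move=> t _; rewrite -tuple_eta.
Qed.

Lemma lsum_imset (T' : finType) (f : T -> T') (m : nat) (F : seq T' -> nat) :
  {in X &, injective f} ->
  lsum (f @: X) m F = lsum X m (fun t => F (map f t)).
Proof.
move=> fI; elim: m F => [|m IH] F //=.
by rewrite big_imset //=; apply: eq_bigr => x _; rewrite IH.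
Qed.

Lemma lsum_restrict (Y : {set T}) (m : nat) (F : seq T -> nat) :
  X \subset Y -> (forall t, ~~ all (mem X) t -> F t = 0) ->
  lsum Y m F = lsum X m F.
Proof.
move=> XY; elim: m F => [|m IH] F F0 //=.
have l0 Z k G : (forall t : seq T, G t = 0) -> lsum Z k G = 0.
  elim: k G => [|k IHk] G G0 //=; apply: big1 => x _; exact: IHk.
rewrite (big_setID X) /= (setIidPr XY) [X in _ + X]big1 ?addn0.
  apply: eq_bigr => x xX; apply: IH => t tX; apply: F0.
  by rewrite /= negb_and tX orbT.
move=> x; rewrite inE => /andP[xX _]; apply: l0 => t; apply: F0.
by rewrite /= negb_and xX.
Qed.

End Lsum.

(** Choose the [j] positions whose entries lie in [X]: [F] sees only these, and the other [m - j]
    entries are free in [Y]. *)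
Lemma lsum_split (T : finType) (X Y : {set T}) (m : nat) (F : seq T -> nat) :
  [disjoint X & Y] ->
  lsum (X :|: Y) m (fun t => F [seq x <- t | x \in X]) =
  \sum_(j < m.+1) 'C(m, j) * lsum X j F * #|Y| ^ (m - j).
Proof.
move=> XY; elim: m F => [|m IH] F /=.
  by rewrite big_ord1 /= bin0 mul1n expn0 muln1.
rewrite (big_setID X) /= setIUl setIid (setIC Y) (disjoint_setI0 XY) setU0.
have -> : (X :|: Y) :\: X = Y.
  apply/setP => x; rewrite !inE; have [xX|] //= := boolP (x \in X).
  by rewrite (disjointFr XY).
rewrite (eq_bigr (fun x => \sum_(j < m.+1)
    'C(m, j) * lsum X j (fun t => F (x :: t)) * #|Y| ^ (m - j))); last first.
  move=> x xX; rewrite -IH; apply: eq_in_lsum => t _ _.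
  by rewrite xX.
rewrite [X in _ + X = _](eq_bigr (fun=> \sum_(j < m.+1)
    'C(m, j) * lsum X j F * #|Y| ^ (m - j))); last first.
  move=> x xY; rewrite -IH; apply: eq_in_lsum => t _ _.
  by rewrite (disjointFl XY).
rewrite exchange_big /= sum_nat_const.
rewrite (pascal_sum (fun j => lsum X j F)); congr (_ + _); apply: eq_bigr => j _.
by rewrite -big_distrl -big_distrr.
Qed.

(** * Ancestors in random digraphs *)

Section Ancestors.
Variable V : finType.
Implicit Types (t s : seq (V * V)) (r v : V) (S : {set V}).

Definition ancestors t r : {set V} :=
  [set v | connect (fun u w => (u, w) \in t) v r].

Lemma ancestors_root t r : r \in ancestors t r.
Proof. by rewrite inE connect0. Qed.

Lemma ancestors_step t r u v :
  (u, v) \in t -> v \in ancestors t r -> u \in ancestors t r.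
Proof. by rewrite !inE => uv; apply: connect_trans; apply: connect1. Qed.

(** Replaces induction on paths: later upper bounds on [ancestors] only exhibit a set closed under
    predecessors. *)
Lemma ancestors_min t r S :
  r \in S -> (forall u v, (u, v) \in t -> v \in S -> u \in S) ->
  ancestors t r \subset S.
Proof.
move=> rS tS; apply/subsetP => v; rewrite inE => /connectP[p].
elim: p v => [v _ /= <- //|w p IH v] /= /andP[vw wp] rp.
by apply: (tS v w vw); apply: IH.
Qed.

Lemma ancestorsS t s r : {subset t <= s} -> ancestors t r \subset ancestors s r.
Proof.
move=> ts; apply: ancestors_min; first exact: ancestors_root.
by move=> u v /ts; apply: ancestors_step.
Qed.

Lemma card_ancestors_gt0 t r : 0 < #|ancestors t r|.
Proof. by apply/card_gt0P; exists r; apply: ancestors_root. Qed.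

(** Every ancestor other than [r] is the tail of some arc of [t]. *)
Lemma card_ancestors_le t r : #|ancestors t r| <= (size t).+1.
Proof.
have sub : ancestors t r \subset r |: [set v in unzip1 t].
  apply: ancestors_min => [|u v uv _]; first by rewrite !inE eqxx.
  by rewrite !inE (map_f fst uv) orbT.
apply: leq_trans (subset_leq_card sub) _.
rewrite cardsU1 -addn1 addnC; apply: leq_add; last by case: (_ \notin _).
rewrite cardsE; apply: leq_trans (card_size _) _.
by rewrite size_map.
Qed.

Definition arcs S : {set V * V} :=
  [set e : V * V | [&& e.1 != e.2, e.1 \in S & e.2 \in S]].

Lemma card_arcs_to S S' : S' \subset S ->
  #|[set e : V * V | [&& e.1 != e.2, e.1 \in S & e.2 \in S']]| =
  #|S|.-1 * #|S'|.
Proof.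
move=> /subsetP S'S.
have -> : [set e : V * V | [&& e.1 != e.2, e.1 \in S & e.2 \in S']] =
    setX S S' :\: [set (v, v) | v in S'].
  apply/setP => -[u v]; rewrite !inE /=; have [->|uv] := eqVneq u v.
    by case vS: (v \in S'); rewrite ?andbF //= imset_f.
  by case: imsetP => // -[w _ [uw vw]]; rewrite uw vw eqxx in uv.
have diagS : [set (v, v) | v in S'] \subset setX S S'.
  by apply/subsetP => _ /imsetP[v vS ->]; rewrite inE /= vS S'S.
rewrite cardsD (setIidPr diagS) cardsX card_imset => [|x y []//].
by rewrite -subn1 mulnBl mul1n.
Qed.

Lemma card_arcs S : #|arcs S| = #|S|.-1 * #|S|.
Proof. exact: card_arcs_to. Qed.

(** No arc enters the set of ancestors from outside, and arcs ending outside it never help to reach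
    [r]. The event thus splits into a condition on each arc and a spanning condition on the arcs
    inside [S]. *)
Lemma ancestors_eqE t r S : r \in S -> all (mem (arcs setT)) t ->
  (ancestors t r == S) =
  all (mem (arcs S :|: [set e in arcs setT | e.2 \notin S])) t &&
  (ancestors [seq e <- t | e \in arcs S] r == S).
Proof.
move=> rS /allP tE; set t' := [seq e <- t | _].
have t't : {subset t' <= t} by move=> e; rewrite mem_filter => /andP[].
apply/eqP/andP => [tS|[/allP tY /eqP t'S]].
  have inS u v : (u, v) \in t -> v \in S -> u \in S.
    by rewrite -tS; apply: ancestors_step.
  split.
    apply/allP => -[u v] uv; have /= := tE _ uv.
    rewrite !inE /= andbT => -> /=; case: (boolP (v \in S)) => vS.
      by rewrite (inS _ _ uv vS).
    by rewrite orbT.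
  rewrite eqEsubset; apply/andP; split; first by rewrite -tS ancestorsS.
  rewrite -tS; apply: ancestors_min; first exact: ancestors_root.
  move=> u v uv vt'; apply: (ancestors_step _ vt'); rewrite mem_filter uv andbT inE.
  have vS : v \in S by rewrite -tS (subsetP (ancestorsS _ t't)).
  by rewrite /= vS (inS _ _ uv vS) andbT; have := tE _ uv; rewrite /= !inE /= andbT.
apply/eqP; rewrite eqEsubset -{2}t'S ancestorsS // andbT.
apply: ancestors_min => // u v uv vS; have /= := tY _ uv.
by rewrite !inE /= vS !andbF orbF => /and3P[].
Qed.

End Ancestors.

Lemma card_arcs_ord (n : nat) : #|arcs [set: 'I_n.+1]| = n * n.+1.
Proof. by rewrite card_arcs cardsT card_ord. Qed.

(** * Counting arc sequences by the number of ancestors *)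

Lemma ancestors_map (V W : finType) (f : V -> W) (t : seq (V * V)) (r : V) :
  injective f ->
  ancestors [seq (f e.1, f e.2) | e <- t] (f r) = f @: ancestors t r.
Proof.
move=> fI; apply/eqP; rewrite eqEsubset; apply/andP; split.
  apply: ancestors_min => [|_ _ /mapP[[u v] uv [-> ->]] /imsetP[w wr /fI vw]].
    by rewrite imset_f ?ancestors_root.
  by rewrite imset_f //; apply: ancestors_step uv _; rewrite vw.
rewrite sub_imset_pre; apply: ancestors_min => [|u v uv].
  by rewrite inE ancestors_root.
rewrite [v \in _]inE [u \in _]inE; apply: ancestors_step.
by apply/mapP; exists (u, v).
Qed.

(** For [j = k] the arcs form a spanning tree directed towards [ord0], so the value is [k!] times
    the number of such trees. *)
Definition spanning_count (k j : nat) : nat :=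
  lsum (arcs [set: 'I_k.+1]) j (fun t => ancestors t ord0 == setT).

Lemma spanning_count_small (k j : nat) : j < k -> spanning_count k j = 0.
Proof.
move=> jk; rewrite -[RHS](muln0 (#|arcs [set: 'I_k.+1]| ^ j)) -lsum_const.
apply: eq_in_lsum => t tj _; case: eqP => // tT.
by have := card_ancestors_le t ord0; rewrite tT cardsT card_ord tj ltnS leqNgt jk.
Qed.

Lemma spanning_count_le (k j : nat) : spanning_count k j <= (k * k.+1) ^ j.
Proof.
rewrite -card_arcs_ord -[_ ^ j]muln1 -lsum_const.
by apply: leq_lsum => t _ _; case: eqP.
Qed.

Lemma spanning_countE (V : finType) (r : V) (S : {set V}) (k j : nat) :
  r \in S -> #|S| = k.+1 ->
  lsum (arcs S) j (fun t => ancestors t r == S) = spanning_count k j.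
Proof.
(* The enumeration of [S] starts with [r], so that the relabelling [f] sends [ord0] to [r]. *)
move=> rS Sk; set s := r :: enum (S :\ r).
have s_size : size s = k.+1.
  by rewrite /= -cardE; move: Sk; rewrite (cardsD1 r) rS add1n => -[->].
have sS : s =i S.
  by move=> v; rewrite inE mem_enum !inE; case: eqVneq => // ->.
have s_uniq : uniq s by rewrite /= mem_enum !inE eqxx enum_uniq.
pose f (i : 'I_k.+1) := nth r s i.
have fI : injective f.
  by move=> i i' /eqP; rewrite nth_uniq ?s_size // => /eqP/val_inj.
have fT : f @: setT = S.
  apply/setP => v; rewrite -sS; apply/imsetP/idP => [[i _ ->]|vs].
    by rewrite mem_nth ?s_size.
  have vk : index v s < k.+1 by rewrite -s_size index_mem.
  by exists (Ordinal vk) => //; rewrite /f nth_index.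
have -> : arcs S = (fun e => (f e.1, f e.2)) @: arcs setT.
  apply/setP => -[u v]; rewrite -fT; apply/idP/imsetP.
    rewrite inE /= => /and3P[+ /imsetP[i _ ui] /imsetP[i' _ vi]].
    rewrite ui vi (inj_eq fI) => ii'.
    by exists (i, i') => //; rewrite !inE ii'.
  case=> -[i i']; rewrite !inE /= => ii' [-> ->].
  by rewrite (inj_eq fI) !imset_f // andbT.
rewrite lsum_imset => [|[a b] [a' b'] _ _ [/fI-> /fI->]//].
apply: eq_in_lsum => t _ _; rewrite -[r in ancestors _ r]/(f ord0) ancestors_map //.
by rewrite -fT (inj_eq (imset_inj fI)).
Qed.

(** The index [k] leaves out the root, which is always its own ancestor. *)
Definition ancestors_count (n m k : nat) : nat :=
  lsum (arcs [set: 'I_n.+1]) m (fun t => #|ancestors t ord0| == k.+1).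

(* Grouping the sequences by the set [S] of ancestors: the arcs inside [S] must
   span [S], and no other arc may end in [S]. *)
Lemma ancestors_countE (n m k : nat) :
  ancestors_count n m k = 'C(n, k) * \sum_(j < m.+1)
    'C(m, j) * spanning_count k j * ((n - k) * n) ^ (m - j).
Proof.
rewrite /ancestors_count.
pose P := [set S : {set 'I_n.+1} | (ord0 \in S) && (#|S| == k.+1)].
have cardP : #|P| = 'C(n, k).
  have -> : P = [set ord0 |: B |
      B in [set B : {set 'I_n.+1} | B \subset [set~ ord0] & #|B| == k]].
    apply/setP => S; rewrite inE; apply/andP/imsetP => [[S0 Sk]|].
      exists (S :\ ord0); last by rewrite setD1K.
      rewrite inE {1}setDE subsetIr /=.
      by move: Sk; rewrite (cardsD1 ord0) S0 add1n eqSS.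
    case=> B; rewrite inE subsetC sub1set inE => /andP[B0 /eqP Bk] ->.
    by rewrite setU11 cardsU1 B0 Bk.
  rewrite card_in_imset ?cards_draws ?cardsC1 ?card_ord // => B B'.
  rewrite !inE !(subsetC _ [set ord0]) !sub1set !inE.
  by move=> /andP[B0 _] /andP[B'0 _] e; rewrite -(setU1K B0) e setU1K.
rewrite (eq_in_lsum (G := fun t => \sum_(S in P) (ancestors t ord0 == S))); last first.
  move=> t _ _; case ak: (_ == k.+1).
    have aP : ancestors t ord0 \in P by rewrite inE ancestors_root ak.
    rewrite (bigD1 _ aP) /= eqxx.
    by rewrite big1 // => S /andP[_]; rewrite eq_sym => /negPf->.
  rewrite big1 // => S; rewrite inE => /andP[_ Sk].
  by case: eqP => // aS; rewrite aS Sk in ak.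
rewrite lsum_sum -cardP -sum_nat_const; apply: eq_bigr => S.
rewrite inE => /andP[S0 /eqP Sk].
(* Each of the [n - k] heads outside [S] admits [n] tails. *)
set Y := [set e in arcs setT | e.2 \notin S].
have cardY : #|Y| = (n - k) * n.
  have := card_arcs_to (subsetT (~: S)).
  rewrite cardsT card_ord (cardsCs (~: S)) setCK Sk card_ord subSS mulnC => <-.
  by apply: eq_card => e; rewrite !inE /= -andbA.
have dXY : [disjoint arcs S & Y].
  by apply/pred0P => e; rewrite !inE /=; case: (e.2 \in S); rewrite !andbF.
rewrite (eq_in_lsum (G := fun t => all (mem (arcs S :|: Y)) t *
    (ancestors [seq e <- t | e \in arcs S] ord0 == S))); last first.
  by move=> t _ tE; rewrite ancestors_eqE // mulnb.
rewrite (@lsum_restrict _ (arcs S :|: Y)) => [|//|t /negPf->//]; last first.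
  apply/subsetP => e; rewrite !inE /=; case/orP; last by case/andP.
  by case/and3P => ->.
rewrite (eq_in_lsum (G := fun t =>
    ancestors [seq e <- t | e \in arcs S] ord0 == S)) => [|t _ ->]; last first.
  by rewrite mul1n.
rewrite (lsum_split m (fun t => (ancestors t ord0 == S : bool)) dXY) cardY; apply: eq_bigr => j _.
by rewrite (spanning_countE _ S0 Sk).
Qed.

(** Used with [h] constant for the total mass, the successor for the mean, and a binomial
    coefficient for satisfiability. *)
Lemma lsum_ancestors (n m : nat) (h : nat -> nat) :
  lsum (arcs [set: 'I_n.+1]) m (fun t => h #|ancestors t ord0|.-1) =
  \sum_(k < n.+1) ancestors_count n m k * h k.
Proof.
rewrite (eq_in_lsum (G := fun t =>
    \sum_(k < n.+1) h k * (#|ancestors t ord0| == k.+1))); last first.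
  move=> t _ _; have a_gt0 := card_ancestors_gt0 t ord0.
  have an : #|ancestors t ord0|.-1 < n.+1.
    by rewrite prednK // (leq_trans (max_card _)) ?card_ord.
  rewrite (bigD1 (Ordinal an)) //= prednK // eqxx muln1 big1 ?addn0 // => i.
  case: (#|_| =P i.+1) => [ai|_ _]; last by rewrite muln0.
  by case/eqP; apply/val_inj; rewrite /= ai.
by rewrite lsum_sum; apply: eq_bigr => k _; rewrite lsumMl mulnC.
Qed.

(* The sum of [G (t_i) t'] over all entries [t_i] of [t], where [t'] is [t]
   without this entry. *)
Fixpoint removal_sum (T : Type) (G : T -> seq T -> nat) (t : seq T) : nat :=
  if t is x :: t' then
    G x t' + removal_sum (fun y s => G y (x :: s)) t'
  else 0.

Lemma eq_removal_sum (T : Type) (G H : T -> seq T -> nat) (t : seq T) :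
  (forall x s, G x s = H x s) -> removal_sum G t = removal_sum H t.
Proof.
elim: t G H => [|x t IH] G H GH //=.
by rewrite GH; congr (_ + _); apply: IH => y s; apply: GH.
Qed.

Lemma removal_sum_sum (T : Type) (I : finType) (G : I -> T -> seq T -> nat)
    (t : seq T) :
  removal_sum (fun x s => \sum_i G i x s) t = \sum_i removal_sum (G i) t.
Proof.
elim: t G => [|x t IH] G /=; first by rewrite big1.
by rewrite IH -big_split.
Qed.

Lemma leq_removal_sum (T : Type) (G : T -> seq T -> nat) (s t : seq T) (x : T) :
  G x (s ++ t) <= removal_sum G (s ++ x :: t).
Proof.
elim: s G => [|y s IH] G /=; first exact: leq_addr.
by apply: leq_trans (leq_addl _ _); apply: (IH (fun z u => G z (y :: u))).
Qed.

(** All [m.+1] positions contribute equally: once an entry is removed, the others form an arbitrary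
    sequence of length [m]. *)
Lemma lsum_removal (T : finType) (X : {set T}) (m : nat)
    (G : T -> seq T -> nat) :
  lsum X m.+1 (removal_sum G) = m.+1 * \sum_(x in X) lsum X m (G x).
Proof.
elim: m G => [|m IH] G.
  by rewrite mul1n /=; apply: eq_bigr => x _; rewrite addn0.
transitivity (\sum_(x in X) (lsum X m.+1 (G x) +
    lsum X m.+1 (removal_sum (fun y s => G y (x :: s))))).
  by apply: eq_bigr => x _; rewrite -lsumD.
rewrite big_split [RHS]mulSn; congr (_ + _).
rewrite (eq_bigr (fun x => m.+1 * \sum_(y in X)
    lsum X m (fun s => G y (x :: s)))) => [|x _]; last exact: IH.
by rewrite -big_distrr exchange_big.
Qed.

(* The last arc [(u, r)] of a shortest path from [v] to [r] is not needed to
   go from [v] to [u]. *)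
Lemma card_ancestors_removal (V : finType) (t : seq (V * V)) (r : V) :
  #|ancestors t r| <=
  1 + removal_sum (fun e s => (e.2 == r) * #|ancestors s e.1|) t.
Proof.
have vP v : v \in ancestors t r -> v != r ->
    0 < removal_sum (fun e s => (e.2 == r) * (v \in ancestors s e.1)) t.
  move=> vr v_r; set t' := [seq e <- t | e.2 != r].
  (* This set collects [r] and the vertices that reach some [u] through arcs not ending in [r],
     where [(u, r)] is an arc. It is closed under predecessors, hence contains all ancestors. *)
  have : v \in [set w | (w == r) || [exists u, ((u, r) \in t) && (w \in ancestors t' u)]].
    apply: (subsetP _ _ vr); apply: ancestors_min => [|x y xy].
      by rewrite inE eqxx.
    rewrite !inE => /orP[/eqP yr|/existsP[u /andP[ur yu]]]; apply/orP; right.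
      by apply/existsP; exists x; rewrite -{1}yr xy ancestors_root.
    have [yr|y_r] := eqVneq y r.
      by apply/existsP; exists x; rewrite -{1}yr xy ancestors_root.
    apply/existsP; exists u; rewrite ur; apply: ancestors_step yu.
    by rewrite mem_filter /= y_r.
  rewrite inE (negPf v_r) => /existsP[u /andP[ur vu]].
  have [s1 [s2 tE]] : exists s1 s2, t = s1 ++ (u, r) :: s2.
    by case/splitPr: ur => s1 s2; exists s1, s2.
  rewrite tE; apply: leq_trans (leq_removal_sum _ _ _ _) => /=.
  (* The arcs of [t'] do not end in [r], so they survive the removal of [(u, r)]. *)
  rewrite eqxx mul1n lt0b; apply: (subsetP (ancestorsS _ _) _ vu) => e.
  rewrite mem_filter tE !mem_cat inE => /andP[er].
  by case: (e =P (u, r)) er => [->|//]; rewrite eqxx.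
rewrite (cardsD1 r) ancestors_root leq_add2l.
apply: (@leq_trans (\sum_v removal_sum
    (fun e s => (e.2 == r) * (v \in ancestors s e.1)) t)); last first.
  rewrite -removal_sum_sum; apply: eq_leq; apply: eq_removal_sum => e s.
  rewrite -big_distrr /=; congr (_ * _); rewrite -sum1_card [RHS]big_mkcond /=.
  by apply: eq_bigr => v _; case: (v \in _).
rewrite -sum1_card big_mkcond; apply: leq_sum => v _.
by rewrite in_setD1; case: eqP => //= /eqP v_r; case: ifP => // vr; apply: vP.
Qed.

Lemma lsum_card_ancestors_rec (V : finType) (m : nat) (r : V) :
  lsum (arcs [set: V]) m.+1 (fun t => #|ancestors t r|) <=
  #|arcs [set: V]| ^ m.+1 +
  m.+1 * \sum_(u in [set~ r]) lsum (arcs setT) m (fun t => #|ancestors t u|).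
Proof.
apply: leq_trans (leq_lsum (fun t _ _ => card_ancestors_removal t r)) _.
rewrite lsumD lsum_const muln1 leq_add2l lsum_removal leq_mul2l /=.
apply/eq_leq; under eq_bigr do rewrite lsumMl.
rewrite (bigID (fun e => e.2 == r)) /= [X in _ + X]big1 ?addn0; last first.
  by move=> e /andP[_ /negPf->].
rewrite (reindex_onto (fun u => (u, r)) fst) /=.
  apply: eq_big => [u|u _]; last by rewrite eqxx mul1n.
  by rewrite !inE /= !eqxx !andbT.
by case=> u v /= /andP[_ /eqP->].
Qed.

(** With [N = #|V|] and [E m] the mean number of ancestors, the recursion reads
    [E (m + 1) <= 1 + (m + 1) / N * E m]. For [m + 1 <= M] it preserves the bound [N / (N - M)]; the
    induction on [m] therefore keeps [M] fixed. *)
Lemma lsum_card_ancestors_le (V : finType) (m : nat) (r : V) : m <= #|V| ->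
  (#|V| - m) * lsum (arcs [set: V]) m (fun t => #|ancestors t r|) <=
  #|V| * #|arcs [set: V]| ^ m.
Proof.
suff gen M : M <= #|V| -> m <= M ->
    (#|V| - M) * lsum (arcs [set: V]) m (fun t => #|ancestors t r|) <=
    #|V| * #|arcs [set: V]| ^ m by move=> mV; apply: gen.
move=> MV; elim: m r => [|m IH] r mM /=.
  rewrite muln1; have -> : ancestors [::] r = [set r].
    apply/eqP; rewrite eqEsubset sub1set ancestors_root andbT.
    by apply: ancestors_min; rewrite ?inE.
  by rewrite cards1 muln1 leq_subr.
apply: (@leq_trans ((#|V| - M) * _)).
  by rewrite leq_mul2l; apply/orP; right; apply: lsum_card_ancestors_rec.
rewrite mulnDr.
apply: (@leq_trans ((#|V| - M) * #|arcs [set: V]| ^ m.+1 +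
    m.+1 * \sum_(u in [set~ r]) #|V| * #|arcs [set: V]| ^ m)).
  rewrite leq_add2l mulnCA leq_mul2l big_distrr /=.
  by apply: leq_sum => u _; apply: IH; apply: ltnW.
rewrite sum_nat_const cardsC1 (mulnA #|V|.-1).
have <- : #|arcs [set: V]| = #|V|.-1 * #|V| by rewrite card_arcs cardsT.
rewrite -expnS -mulnDl leq_mul2r; apply/orP; right.
by apply: leq_trans (leq_add (leqnn _) mM) _; rewrite subnK.
Qed.

(** * Horn formulas as digraphs *)

Definition arc_clause (n : nat) (e : 'I_n * 'I_n) : clause n :=
  [set (true, e.2); (false, e.1)].

Lemma arc_clause_inj (n : nat) : injective (@arc_clause n).
Proof.
move=> [i j] [i' j'] /= /setP e.
have := e (true, j); rewrite !inE !xpair_eqE !eqxx /= orbF => /esym/eqP->.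
by have := e (false, i); rewrite !inE !xpair_eqE !eqxx /= => /esym/eqP->.
Qed.

Lemma binary_horn_clausesE (n : nat) :
  binary_horn_clauses n = @arc_clause n @: arcs [set: 'I_n].
Proof.
apply/setP => C; rewrite inE; apply/existsP/imsetP => [[i /existsP[j]]|].
  by case/andP=> ij /eqP->; exists (j, i); rewrite // !inE eq_sym ij.
case=> -[i j]; rewrite !inE !andbT => ij ->.
by exists j; apply/existsP; exists i; rewrite eq_sym ij eqxx.
Qed.

(** The variables false under a satisfying assignment include [ord0] and are closed under
    predecessors, so they contain all ancestors. Conversely, setting exactly the ancestors to false
    satisfies every clause. *)
Lemma satisfiable_ancestors (n : nat) (U : {set 'I_n.+1})
    (t : seq ('I_n.+1 * 'I_n.+1)) :
  satisfiable ([set (false, ord0)] ::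
    [seq [set (true, i)] | i <- enum U] ++ [seq arc_clause e | e <- t]) =
  (U \subset ~: ancestors t ord0).
Proof.
apply/existsP/subsetP => [[a /= /andP[a0]]|UA].
  rewrite all_cat => /andP[/allP aU /allP at_] i iU.
  have : [set (true, i)] \in [seq [set (true, i)] | i <- enum U].
    by apply: map_f; rewrite mem_enum.
  move/aU => /existsP[l]; rewrite inE => /andP[/eqP-> /= ai].
  rewrite inE; apply/negP => ia; move: ai.
  have : i \in [set v | ~~ a v].
    apply: (subsetP _ _ ia); apply: ancestors_min.
      move: a0 => /existsP[l']; rewrite !inE => /andP[/eqP-> /=].
      by case: (a ord0).
    move=> u v uv; have /existsP[l'] := at_ _ (map_f _ uv).
    by rewrite !inE => /andP[/orP[] /eqP-> /= /eqP->].
  by rewrite inE; case: (a i).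
exists [ffun v => v \notin ancestors t ord0] => /=; apply/andP; split.
  by apply/existsP; exists (false, ord0); rewrite inE ffunE ancestors_root eqxx.
rewrite all_cat; apply/andP; split; apply/allP => C /mapP[].
  move=> i; rewrite mem_enum => /UA; rewrite inE => iA ->.
  by apply/existsP; exists (true, i); rewrite inE ffunE iA eqxx.
move=> [u v] uv ->; apply/existsP.
case: (boolP (v \in ancestors t ord0)) => vA; last first.
  by exists (true, v); rewrite !inE ffunE vA eqxx.
exists (false, u); rewrite !inE ffunE eqxx orbT /=.
by rewrite (ancestors_step uv vA).
Qed.

(** Fixes the binary clauses first and counts the unit sets second. A general [Q] gives both the
    numerator and the denominator of the probability. *)
Lemma card_horn_outcomes_pred (n k1 k2 : nat) (Q : {set 'I_n.+1} -> formula n.+1 -> bool) :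
  #|[set w in horn_outcomes n k1 k2 | Q w.1 w.2]| =
  lsum (arcs [set: 'I_n.+1]) k2 (fun t =>
    #|[set U : {set 'I_n.+1} | [&& U \subset [set~ ord0], #|U| == k1 &
      Q U [seq arc_clause e | e <- t]]]|).
Proof.
rewrite -[RHS](lsum_imset _ (fun F : formula n.+1 => #|[set U : {set 'I_n.+1} |
  [&& U \subset [set~ ord0], #|U| == k1 & Q U F]]|) (in2W (@arc_clause_inj _))).
rewrite -binary_horn_clausesE.
rewrite -sum_tuple_lsum -sum1_card.
under [RHS]eq_bigr do rewrite -sum1_card.
rewrite (exchange_big_dep xpredT) //= pair_big_dep /=.
apply: eq_bigl => -[U t]; rewrite !inE /= [RHS]andbC -!andbA.
by rewrite -[Q U t && _]andbC.
Qed.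

Lemma card_horn_outcomes (n k1 k2 : nat) :
  #|horn_outcomes n k1 k2| = 'C(n, k1) * (n * n.+1) ^ k2.
Proof.
have -> : horn_outcomes n k1 k2 = [set w in horn_outcomes n k1 k2 | true].
  by apply/setP => w; rewrite !inE andbT.
rewrite (card_horn_outcomes_pred k1 k2 (fun _ _ => true)).
rewrite (eq_in_lsum (G := fun=> 'C(n, k1))) => [|t _ _].
  by rewrite lsum_const card_arcs_ord mulnC.
rewrite -[n in RHS]/(n.+1.-1) -[n.+1 in RHS]card_ord -(cardsC1 ord0) -cards_draws.
by apply: eq_card => U; rewrite !inE andbT.
Qed.

Lemma card_satisfiable (n k1 k2 : nat) :
  #|[set w in horn_outcomes n k1 k2 | satisfiable (horn_formula w)]| =
  \sum_(k < n.+1) ancestors_count n k2 k * 'C(n - k, k1).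
Proof.
rewrite (card_horn_outcomes_pred k1 k2 (fun U F => satisfiable
  ([set (false, ord0)] :: [seq [set (true, i)] | i <- enum U] ++ F))).
rewrite -(lsum_ancestors _ _ (fun k => 'C(n - k, k1))).
apply: eq_in_lsum => t _ _.
have <- : #|~: ancestors t ord0| = n - #|ancestors t ord0|.-1.
  rewrite cardsCs setCK card_ord.
  by case: #|_| (card_ancestors_gt0 t ord0) => //= k _; rewrite subSS.
rewrite -cards_draws; apply: eq_card => U; rewrite !inE satisfiable_ancestors.
rewrite andbCA andbC; congr (_ && _).
(* A unit set avoiding the ancestors avoids [ord0] in particular. *)
apply/andP/idP => [[]//|UA]; split=> //; apply: subset_trans UA _.
by rewrite setCS sub1set ancestors_root.
Qed.

From mathcomp Require Import all_order all_algebra ring lra.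
From mathcomp Require Import all_classical all_reals all_analysis.
Import Order.TTheory GRing.Theory Num.Theory.
Import numFieldNormedType.Exports.
Local Open Scope ring_scope.
Local Open Scope classical_set_scope.

(** * Elementary limits *)

Section Limits.
Variable R : realType.

Lemma cvg_near_eq (f g : nat -> R) (l : R) :
  (\forall n \near \oo, f n = g n) -> g n @[n --> \oo] --> l ->
  f n @[n --> \oo] --> l.
Proof.
by move=> fg; apply: cvg_trans; apply: near_eq_cvg; apply: filterS fg => n ->.
Qed.

Lemma cvg_ord_sum (K : nat) (f : nat -> nat -> R) (l : nat -> R) :
  (forall k, f n k @[n --> \oo] --> l k) ->
  (\sum_(k < K) f n k) @[n --> \oo] --> \sum_(k < K) l k.
Proof.
move=> fl; apply: cvg_big => [|k _]; last exact: fl.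
exact: add_continuous.
Qed.

Lemma cvg_exprn (f : nat -> R) (l : R) (k : nat) :
  f n @[n --> \oo] --> l -> (f n ^+ k) @[n --> \oo] --> l ^+ k.
Proof. by move=> fl; apply: (continuous_cvg _ (@exprn_continuous R k l) fl). Qed.

(** Raising [k] by one multiplies the quotient by [(m n - k) / D n / (k + 1)], and [k / D n]
    vanishes in the limit. *)
Lemma cvg_binomial (m : nat -> nat) (D : nat -> R) (d : R) (k : nat) :
  (\forall n \near \oo, D n != 0) -> (D n)^-1 @[n --> \oo] --> (0 : R) ->
  (m n)%:R / D n @[n --> \oo] --> d ->
  'C(m n, k)%:R / D n ^+ k @[n --> \oo] --> d ^+ k / k`!%:R.
Proof.
move=> D0 D_oo mD; elim: k => [|k IH].
  rewrite !expr0 divr1; apply: cvg_near_cst; apply: nearW => n.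
  by rewrite bin0 divr1.
have -> : d ^+ k.+1 / k.+1`!%:R = d ^+ k / k`!%:R * (d - k%:R * 0) * k.+1%:R^-1.
  by rewrite factS natrM invfM exprS; ring.
have : 'C(m n, k)%:R / D n ^+ k * ((m n)%:R / D n - k%:R * (D n)^-1) *
    k.+1%:R^-1 @[n --> \oo] --> d ^+ k / k`!%:R * (d - k%:R * 0) * k.+1%:R^-1.
  by apply: cvgMl; apply: cvgM => //; apply: cvgB => //; apply: cvgMr.
apply: cvg_near_eq; apply: filterS D0 => n Dn.
have /(congr1 (fun i => i%:R : R)) := mul_bin_left (m n) k.
rewrite !natrM => binE.
have -> : 'C(m n, k.+1)%:R = (m n - k)%:R * 'C(m n, k)%:R / k.+1%:R :> R.
  by rewrite -binE mulrAC divff ?mul1r // pnatr_eq0.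
(* Where the natural subtraction truncates, the binomial coefficient is already 0. *)
have [km|mk] := leqP k (m n).
  rewrite natrB // exprS; field.
  by rewrite Dn expf_neq0 //= [1 + _]addrC natr1 pnatr_eq0.
by rewrite bin_small // !(mulr0, mul0r).
Qed.

Lemma cvg_invS : (n.+1%:R^-1 : R) @[n --> \oo] --> (0 : R).
Proof. exact: cvg_harmonic. Qed.

Lemma cvg_invn : (n%:R^-1 : R) @[n --> \oo] --> (0 : R).
Proof. by rewrite -cvg_shiftS; apply: cvg_invS. Qed.

Lemma cvg_truncn (d : R) : 0 <= d ->
  (Num.truncn (d * n.+1%:R))%:R / n.+1%:R @[n --> \oo] --> d.
Proof.
move=> d0; apply: (@squeeze_cvgr _ _ _ _ (fun n => d - n.+1%:R^-1) (fun=> d)).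
- near=> n; have N0 : 0 < n.+1%:R :> R by rewrite ltr0n.
  have /truncn_itv/andP[le lt] : 0 <= d * n.+1%:R by rewrite mulr_ge0.
  rewrite ler_pdivrMr // le andbT ler_pdivlMr // mulrBl mulVf ?gt_eqF //.
  by rewrite lerBlDr natr1 ltW.
- by rewrite -[X in _ --> X]subr0; apply: cvgB; [apply: cvg_cst|apply: cvg_invS].
- exact: cvg_cst.
Unshelve. all: by end_near. Qed.

(** Squeezes the power between [expR (- z m / (1 - z))] and [expR (- z m)]; both bounds come from
    [1 + x <= expR x], at [x = z / (1 - z)] and [x = - z]. *)
Lemma cvg_pow_expR (z : nat -> R) (m : nat -> nat) (a : R) :
  (\forall n \near \oo, 0 <= z n) -> z n @[n --> \oo] --> (0 : R) ->
  z n * (m n)%:R @[n --> \oo] --> a ->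
  (1 - z n) ^+ m n @[n --> \oo] --> expR (- a).
Proof.
move=> z_ge0 z0 zm.
have z_lt1 : \forall n \near \oo, z n < 1 by exact: (@cvgr_lt _ _ _ _ _ _ z0 _ ltr01).
apply: (@squeeze_cvgr _ _ _ _ (fun n => expR (- (z n * (m n)%:R / (1 - z n))))
  (fun n => expR (- (z n * (m n)%:R)))).
- near=> n.
  have zn0 : 0 <= z n by near: n.
  have zn1 : 0 < 1 - z n by rewrite subr_gt0; near: n.
  have -> : - (z n * (m n)%:R / (1 - z n)) = - (z n / (1 - z n)) * (m n)%:R by ring.
  have -> : - (z n * (m n)%:R) = - z n * (m n)%:R by ring.
  rewrite !expRM_natr; apply/andP; split; last first.
    by apply: lerXn2r; rewrite ?nnegrE ?expR_ge0 ?(ltW zn1) ?expR_ge1Dx.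
  apply: lerXn2r; rewrite ?nnegrE ?expR_ge0 ?(ltW zn1) //.
  rewrite expRN -[leRHS]invrK lef_pV2 ?posrE ?expR_gt0 ?invr_gt0 //.
  apply: le_trans (expR_ge1Dx _); rewrite le_eqVlt; apply/orP; left.
  by apply/eqP; field; rewrite gt_eqF.
- have -> : - a = - (a / (1 - 0)) by rewrite subr0 divr1.
  apply: (continuous_cvg _ (@continuous_expR R _)); apply: cvgN; apply: cvgM => //.
  apply: cvgV; first by rewrite subr0 oner_eq0.
  by apply: cvgB => //; apply: cvg_cst.
- by apply: (continuous_cvg _ (@continuous_expR R _)); apply: cvgN.
Unshelve. all: by end_near. Qed.

End Limits.

(** * The limit law of the number of ancestors *)

Lemma leq_bin_expn (n k : nat) : ('C(n, k) <= n ^ k)%N.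
Proof.
elim: k => [|k IH]; first by rewrite bin0.
apply: (@leq_trans (k.+1 * 'C(n, k.+1))%N); first exact: leq_pmull.
by rewrite mul_bin_left expnS leq_mul // leq_subr.
Qed.

Section AncestorsLaw.
Variable R : realType.

Definition ancestors_prob (n m k : nat) : R :=
  (ancestors_count n m k)%:R / ((n * n.+1) ^ m)%:R.

(* The value is [(k + 1) ^ (k - 1) / k!] by Cayley's formula; only its
   independence of the clause density is needed, see [cvg_tree_series]. *)
Definition tree_coef (k : nat) : R :=
  (spanning_count k k)%:R / k`!%:R ^+ 2.

(** The contribution of sequences with exactly [j] arcs inside the set of ancestors; each other arc
    ends outside it, with probability [(n - k) / (n + 1)]. *)
Definition ancestors_term (n m k j : nat) : R :=
  'C(n, k)%:R * 'C(m, j)%:R * (spanning_count k j)%:R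
    / (n%:R * n.+1%:R) ^+ j * ((n - k)%:R / n.+1%:R) ^+ (m - j).

Lemma ancestors_term_ge0 n m k j : 0 <= ancestors_term n m k j.
Proof.
by apply: mulr_ge0; [apply: divr_ge0|]; rewrite ?exprn_ge0 ?mulr_ge0 ?divr_ge0.
Qed.

Lemma ancestors_probE n m k : (0 < n)%N ->
  ancestors_prob n m k = \sum_(j < m.+1) ancestors_term n m k j.
Proof.
move=> n0; rewrite /ancestors_prob ancestors_countE natrM natr_sum -mulrA mulr_suml mulr_sumr.
apply: eq_bigr => j _; rewrite !natrM !natrX !natrM /ancestors_term.
have n_neq0 : n%:R != 0 :> R by rewrite pnatr_eq0 -lt0n.
have N_neq0 : n.+1%:R != 0 :> R by rewrite pnatr_eq0.
have -> : (n%:R * n.+1%:R : R) ^+ m =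
    (n%:R * n.+1%:R) ^+ j * ((n%:R * n.+1%:R) ^+ (m - j)).
  by rewrite -exprD subnKC // -ltnS.
rewrite invfM -!mulrA; congr (_ * (_ * (_ * _))).
rewrite mulrCA; congr (_ * _).
rewrite -expr_div_n; congr (_ ^+ _); field.
by rewrite addrC natr1 N_neq0.
Qed.

(* With more than [k] arcs inside the set of the [k + 1] ancestors, each extra
   arc costs a factor of order [1 / n]. *)
Lemma ancestors_prob_term n m k (q : R) : (0 < n)%N ->
  q = m%:R * (k * k.+1)%:R / (n%:R * n.+1%:R) -> q <= 2^-1 ->
  0 <= ancestors_prob n m k - ancestors_term n m k k <=
  2 * n%:R ^+ k * q ^+ k.+1.
Proof.
move=> n0 qE q2.
have q0 : 0 <= q by rewrite qE divr_ge0 ?mulr_ge0.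
have r0 : 0 <= (n - k)%:R / n.+1%:R :> R by rewrite divr_ge0.
have r1 : (n - k)%:R / n.+1%:R <= 1 :> R.
  by rewrite ler_pdivrMr ?ltr0n // mul1r ler_nat (leq_trans (leq_subr _ _)).
have termE : ancestors_prob n m k - ancestors_term n m k k =
    \sum_(i < m) ancestors_term n m k (k.+1 + i).
  have T0 j : (j < k)%N || (m < j)%N -> ancestors_term n m k j = 0.
    rewrite /ancestors_term => /orP[jk|mj].
      by rewrite (spanning_count_small jk) mulr0 !mul0r.
    by rewrite (bin_small mj) mulr0 !mul0r.
  rewrite ancestors_probE // -(big_mkord xpredT (ancestors_term n m k)).
  have -> : \sum_(0 <= j < m.+1) ancestors_term n m k j =
      \sum_(0 <= j < k.+1 + m) ancestors_term n m k j.
    rewrite [RHS](@big_cat_nat _ _ _ m.+1) //=; last by rewrite addSn ltnS leq_addl.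
    rewrite [X in _ + X]big_nat_cond [X in _ + X]big1 ?addr0 // => j.
    by move=> /andP[/andP[mj _] _]; rewrite T0 // mj orbT.
  rewrite (@big_cat_nat _ _ _ k.+1) ?leq_addr //= big_nat_recr //= big_nat_cond.
  rewrite big1 ?add0r => [|j /andP[/andP[_ jk] _]]; last by rewrite T0 // jk.
  rewrite addrC addrK -{1}[k.+1]add0n big_addn addKn big_mkord.
  by apply: eq_bigr => i _; rewrite addnC.
rewrite termE sumr_ge0 => [/=|i _]; last exact: ancestors_term_ge0.
(* Bounds the binomial coefficients by [n ^ k] and [m ^ j], the spanning count by [(k * k.+1) ^ j],
   and the last factor by 1. *)
apply: (@le_trans _ _ (\sum_(i < m) n%:R ^+ k * q ^+ k.+1 * q ^+ i)).
  apply: ler_sum => i _; rewrite -mulrA -exprD /ancestors_term -[leRHS]mulr1.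
  apply: ler_pM => //; last exact: exprn_ile1.
  rewrite qE expr_div_n -!natrX -!natrM !mulrA.
  rewrite ler_wpM2r ?invr_ge0 //.
  rewrite -natrX -natrM expnMn mulnA ler_nat leq_mul //; last exact: spanning_count_le.
  by rewrite leq_mul // leq_bin_expn.
rewrite -mulr_sumr mulrC [leRHS](_ : _ = 2 * (n%:R ^+ k * q ^+ k.+1)); last by ring.
apply: ler_wpM2r; first by rewrite mulr_ge0 ?exprn_ge0.
(* The geometric sum satisfies [(1 - q) * s = 1 - q ^+ m <= 1], hence [s <= 2] as [q <= 1 / 2]. *)
have /eqP := subrX1 q m.
rewrite -subr_eq0; set s := \sum_(i < m) _ => /eqP e.
have qm0 : 0 <= q ^+ m by rewrite exprn_ge0.
have s0 : 0 <= s by apply: sumr_ge0 => i _; rewrite exprn_ge0.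
nra.
Qed.

End AncestorsLaw.

Section AncestorsLimits.
Variable R : realType.

Lemma cvg_ancestors_term (m : nat -> nat) (d : R) (k : nat) :
  (m n)%:R / n.+1%:R @[n --> \oo] --> d ->
  ancestors_term R n (m n) k k @[n --> \oo] -->
  tree_coef R k * d ^+ k * expR (- (d * k.+1%:R)).
Proof.
(* Chosen so that [1 - z n = (n - k) / (n + 1)] for [k <= n]. *)
move=> md; pose z n : R := k.+1%:R * n.+1%:R^-1.
have z0 : z n @[n --> \oo] --> (0 : R).
  by rewrite -(mulr0 k.+1%:R); apply: cvgMr; apply: cvg_invS.
have mkd : (m n - k)%:R / n.+1%:R @[n --> \oo] --> d.
  apply: (@squeeze_cvgr _ _ _ _ (fun n => (m n)%:R / n.+1%:R - k%:R * n.+1%:R^-1)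
    (fun n => (m n)%:R / n.+1%:R)) => //.
    apply: nearW => n; rewrite -mulrBl !ler_wpM2r ?invr_ge0 ?ler_nat ?leq_subr //.
    by rewrite lerBlDr -natrD ler_nat addnC -leq_subLR.
  rewrite -[X in _ --> X]subr0 -(mulr0 k%:R).
  by apply: cvgB => //; apply: cvgMr; apply: cvg_invS.
have pow : (1 - z n) ^+ (m n - k) @[n --> \oo] --> expR (- (d * k.+1%:R)).
  apply: cvg_pow_expR => //; first by apply: nearW => n; rewrite mulr_ge0.
  rewrite mulrC (_ : (fun n => _) = fun n => k.+1%:R * ((m n - k)%:R / n.+1%:R)).
    exact: cvgMr.
  by apply/funext => n; rewrite /z; ring.
have n_neq0 : \forall n \near \oo, (n%:R : R) != 0.
  by near=> n; rewrite pnatr_eq0 -lt0n; near: n; apply: nbhs_infty_ge.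
have binn : 'C(n, k)%:R / n%:R ^+ k @[n --> \oo] --> (1 ^+ k / k`!%:R : R).
  apply: (cvg_binomial (m := id)) => //; first exact: cvg_invn.
  apply: cvg_near_cst; apply: filterS n_neq0 => n n0 /=.
  by rewrite divff.
have binm : 'C(m n, k)%:R / n.+1%:R ^+ k @[n --> \oo] --> d ^+ k / k`!%:R.
  apply: cvg_binomial => //; last exact: cvg_invS.
  by apply: nearW => n; rewrite pnatr_eq0.
have -> : tree_coef R k * d ^+ k * expR (- (d * k.+1%:R)) =
    1 ^+ k / k`!%:R * (d ^+ k / k`!%:R) * (spanning_count k k)%:R *
    expR (- (d * k.+1%:R)).
  rewrite /tree_coef expr1n; congr (_ * _); field.
  by rewrite pnatr_eq0 -lt0n fact_gt0.
apply: (@cvg_near_eq _ _ (fun n => 'C(n, k)%:R / n%:R ^+ k *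
    ('C(m n, k)%:R / n.+1%:R ^+ k) * (spanning_count k k)%:R *
    (1 - z n) ^+ (m n - k))); last by apply: cvgM => //; apply: cvgMl; apply: cvgM.
near=> n.
have nk : (k <= n)%N by near: n; apply: nbhs_infty_ge.
have n0 : n%:R != 0 :> R by near: n.
have -> : 1 - z n = (n - k)%:R / n.+1%:R.
  rewrite /z natrB //; field.
  by rewrite addrC natr1 pnatr_eq0.
rewrite /ancestors_term exprMn; congr (_ * _); field.
by rewrite !expf_neq0 // addrC natr1 pnatr_eq0.
Unshelve. all: by end_near. Qed.

(** Only the tree term survives: the error is at most [2 * (n * q n) ^+ k.+1 / n], where [n * q n]
    converges. *)
Lemma cvg_ancestors_prob (m : nat -> nat) (d : R) (k : nat) :
  (m n)%:R / n.+1%:R @[n --> \oo] --> d ->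
  ancestors_prob R n (m n) k @[n --> \oo] -->
  tree_coef R k * d ^+ k * expR (- (d * k.+1%:R)).
Proof.
move=> md; set l := (X in _ --> X).
pose q n : R := (m n)%:R * (k * k.+1)%:R / (n%:R * n.+1%:R).
have n_gt0 : \forall n \near \oo, (0 < n)%N by apply: nbhs_infty_ge.
have nq : (n%:R * q n) @[n --> \oo] --> d * (k * k.+1)%:R.
  apply: (@cvg_near_eq _ _ (fun n => (m n)%:R / n.+1%:R * (k * k.+1)%:R)).
    apply: filterS n_gt0 => n n0.
    by rewrite /q; field; rewrite addrC natr1 !pnatr_eq0 -!lt0n n0.
  exact: cvgMl.
have q0 : q n @[n --> \oo] --> (0 : R).
  rewrite -(mulr0 (d * (k * k.+1)%:R)).
  apply: (@cvg_near_eq _ _ (fun n => n%:R * q n * n%:R^-1)).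
    by apply: filterS n_gt0 => n n0; field; rewrite pnatr_eq0 -lt0n.
  by apply: cvgM => //; apply: cvg_invn.
have q2 : \forall n \near \oo, q n <= 2^-1.
  by apply: (@cvgr_le _ _ _ _ _ _ q0); rewrite invr_gt0.
have err : (ancestors_prob R n (m n) k - ancestors_term R n (m n) k k)
    @[n --> \oo] --> (0 : R).
  apply: (@squeeze_cvgr _ _ _ _ (fun=> 0)
      (fun n => 2 * ((n%:R * q n) ^+ k.+1 * n%:R^-1))).
  - near=> n; have n0 : (0 < n)%N by near: n.
    have -> : 2 * ((n%:R * q n) ^+ k.+1 * n%:R^-1) = 2 * n%:R ^+ k * q n ^+ k.+1.
      by rewrite exprMn exprS; field; rewrite pnatr_eq0 -lt0n.
    by apply: ancestors_prob_term => //; near: n.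
  - exact: cvg_cst.
  - rewrite -(mulr0 2); apply: cvgMr; rewrite -(mulr0 ((d * (k * k.+1)%:R) ^+ k.+1)).
    by apply: cvgM; [apply: cvg_exprn|apply: cvg_invn].
rewrite -[l]add0r; apply: (@cvg_near_eq _ _ (fun n =>
    ancestors_prob R n (m n) k - ancestors_term R n (m n) k k +
    ancestors_term R n (m n) k k)); last by apply: cvgD => //; apply: cvg_ancestors_term.
by apply: nearW => n; rewrite subrK.
Unshelve. all: by end_near. Qed.

Lemma ancestors_prob_ge0 n m k : 0 <= ancestors_prob R n m k.
Proof. by rewrite divr_ge0. Qed.

Lemma sum_ancestors_prob n m : (0 < n)%N ->
  \sum_(k < n.+1) ancestors_prob R n m k = 1.
Proof.
move=> n0; rewrite -mulr_suml.
have := lsum_ancestors n m (fun=> 1%N); rewrite lsum_const card_arcs_ord muln1.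
under [X in _ = X -> _]eq_bigr do rewrite muln1.
rewrite -natr_sum => <-; apply: divff.
by rewrite pnatr_eq0 -lt0n expn_gt0 muln_gt0 n0.
Qed.

Lemma ancestors_prob_mean n m : (0 < n)%N -> (m <= n.+1)%N ->
  (n.+1%:R - m%:R) * \sum_(k < n.+1) ancestors_prob R n m k * k.+1%:R <= n.+1%:R.
Proof.
move=> n0 mn; have A0 : 0 < ((n * n.+1) ^ m)%:R :> R.
  by rewrite ltr0n expn_gt0 muln_gt0 n0.
rewrite -(ler_pM2r A0) -mulrA mulr_suml -natrB //.
under eq_bigr do rewrite mulrAC divfK ?gt_eqF // -natrM.
rewrite -natr_sum -(lsum_ancestors _ _ S) -!natrM ler_nat.
have := @lsum_card_ancestors_le 'I_n.+1 m ord0; rewrite card_ord card_arcs_ord.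
move=> /(_ mn); apply: leq_trans; rewrite leq_mul2l; apply/orP; right.
by apply: leq_lsum => t _ _; rewrite prednK // card_ancestors_gt0.
Qed.

(** Markov's inequality: the tail concerns more than [K] ancestors, and their mean number is at most
    [1 / (1 - d)]. *)
Lemma ancestors_prob_tail n m (d : R) K : (0 < n)%N -> (K <= n)%N ->
  d < 1 -> m%:R <= d * n.+1%:R ->
  `|1 - \sum_(k < K) ancestors_prob R n m k| <= (1 - d)^-1 / K.+1%:R.
Proof.
move=> n0 Kn d1 md.
have N0 : 0 < n.+1%:R :> R by rewrite ltr0n.
have mN : (m <= n.+1)%N.
  by rewrite -(ler_nat R) (le_trans md) // ler_piMl // ltW.
rewrite -{1}(sum_ancestors_prob m n0).
rewrite -(big_mkord xpredT (ancestors_prob R n m)).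
rewrite -[X in _ - X](big_mkord xpredT (ancestors_prob R n m)).
rewrite (@big_cat_nat _ _ _ K) ?leqW //= addrC addrK ger0_norm; last first.
  by apply: sumr_ge0 => k _; apply: ancestors_prob_ge0.
rewrite ler_pdivlMr ?ltr0n // -[leRHS]mul1r ler_pdivlMr ?subr_gt0 //.
set S := \sum_(_ <= _ < _) _.
have SE : S * K.+1%:R <= \sum_(k < n.+1) ancestors_prob R n m k * k.+1%:R.
  rewrite -(big_mkord xpredT (fun k => ancestors_prob R n m k * k.+1%:R)).
  rewrite (@big_cat_nat _ _ _ K 0 n.+1) ?leqW //= -[leLHS]add0r; apply: lerD.
    by apply: sumr_ge0 => k _; rewrite mulr_ge0 ?ancestors_prob_ge0.
  rewrite mulr_suml; apply: ler_sum_nat => k /andP[Kk _]; rewrite ler_wpM2l ?ancestors_prob_ge0 //.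
  by rewrite ler_nat.
have S0 : 0 <= S * K.+1%:R.
  by rewrite mulr_ge0 // sumr_ge0 // => k _; apply: ancestors_prob_ge0.
rewrite -(ler_pM2r N0); apply: (@le_trans _ _ (S * K.+1%:R * (n.+1%:R - m%:R))).
  by rewrite -(mulrA (S * _)) ler_wpM2l // mulrBl mul1r lerD2l lerN2.
rewrite mul1r; apply: le_trans (ancestors_prob_mean n0 mN).
by rewrite mulrC ler_wpM2l // subr_ge0 ler_nat.
Qed.

(* For [d < 1] the number of ancestors is tight, so its limit law has total
   mass 1; this determines the generating function of [tree_coef]. *)
Lemma cvg_tree_series (d : R) : 0 <= d -> d < 1 ->
  (\sum_(k < K) tree_coef R k * (d * expR (- d)) ^+ k) @[K --> \oo] --> expR d.
Proof.
move=> d0 d1.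
have tight : (\sum_(k < K) tree_coef R k * d ^+ k * expR (- (d * k.+1%:R)))
    @[K --> \oo] --> (1 : R).
  set u := (fun K : nat => _).
  (* The tail bound is uniform in [n], so it passes to the limit in [n] for fixed [K]. *)
  have close K : `|1 - u K| <= (1 - d)^-1 / K.+1%:R.
    have cvg_norm1 : `|1 - \sum_(k < K)
        ancestors_prob R n (Num.truncn (d * n.+1%:R)) k| @[n --> \oo] --> `|1 - u K|.
      apply: cvg_norm; apply: cvgB; first exact: cvg_cst.
      apply: (@cvg_ord_sum _ _
        (fun n => ancestors_prob R n (Num.truncn (d * n.+1%:R)))
        (fun k => tree_coef R k * d ^+ k * expR (- (d * k.+1%:R)))) => k.
      exact/cvg_ancestors_prob/cvg_truncn.
    apply: (cvgr_to_le cvg_norm1); near=> n.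
    apply: ancestors_prob_tail => //; try by near: n; apply: nbhs_infty_ge.
    by rewrite truncn_le mulr_ge0.
  have : (1 - u K) @[K --> \oo] --> (0 : R).
    apply: norm_cvg0; apply: (@squeeze_cvgr _ _ _ _ (fun=> 0)
      (fun K => (1 - d)^-1 / K.+1%:R)).
    - by apply: nearW => K; rewrite normr_ge0 close.
    - exact: cvg_cst.
    - by rewrite -(mulr0 (1 - d)^-1); apply: cvgMr; apply: cvg_invS.
  move=> h; rewrite -[X in _ --> X]subr0.
  apply: (@cvg_near_eq _ _ (fun K => 1 - (1 - u K))).
    by apply: nearW => K; rewrite subKr.
  by apply: cvgB => //; apply: cvg_cst.
rewrite -[expR d]mulr1; apply: (@cvg_near_eq _ _ (fun K => expR d *
    \sum_(k < K) tree_coef R k * d ^+ k * expR (- (d * k.+1%:R)))); last exact: cvgMr.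
apply: nearW => K; rewrite mulr_sumr; apply: eq_bigr => k _.
rewrite -[k.+1]addn1 natrD mulrDr mulr1 opprD expRD -mulNr expRM_natr exprMn.
by rewrite expRN; field; rewrite gt_eqF // expR_gt0.
Unshelve. all: by end_near. Qed.

End AncestorsLimits.

(** * Satisfiability *)

Section Satisfiability.
Variable R : realType.

(** The probability that a uniform set of [a] out of [n] elements misses [k] given ones. *)
Definition avoid_prob (n a k : nat) : R := 'C(n - k, a)%:R / 'C(n, a)%:R.

Lemma horn_sat_probE (d1 d2 : R) (n : nat) :
  horn_sat_prob d1 d2 n = \sum_(k < n.+1)
    ancestors_prob R n (Num.truncn (d2 * n.+1%:R)) k *
    avoid_prob n (Num.truncn (d1 * n.+1%:R)) k.
Proof.
rewrite /horn_sat_prob /finite_uniform_prob card_horn_outcomes card_satisfiable.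
rewrite natr_sum mulr_suml; apply: eq_bigr => k _.
by rewrite !natrM invfM [X in _ * X]mulrC mulrACA.
Qed.

Lemma avoid_prob0 n a : (a <= n)%N -> avoid_prob n a 0 = 1.
Proof. by move=> an; rewrite /avoid_prob subn0 divff // pnatr_eq0 -lt0n bin_gt0. Qed.

Lemma avoid_probS n a k : (k < n)%N ->
  avoid_prob n a k.+1 = avoid_prob n a k * ((n - k - a)%:R / (n - k)%:R).
Proof.
move=> kn; have nk0 : (n - k)%:R != 0 :> R by rewrite pnatr_eq0 subn_eq0 -ltnNge.
have /(congr1 (fun i => i%:R : R)) := mul_bin_down (n - k) a.
rewrite !natrM -subnS => e.
have -> : avoid_prob n a k.+1 =
    (n - k - a)%:R * 'C(n - k, a)%:R / (n - k)%:R / 'C(n, a)%:R.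
  by rewrite -e [_ * 'C(_, _)%:R]mulrC mulfK.
by rewrite /avoid_prob; ring.
Qed.

Lemma avoid_prob_ge0 n a k : 0 <= avoid_prob n a k.
Proof. by rewrite divr_ge0. Qed.

(** Each factor in [avoid_probS] is at most [1 - a / n], since [n - k <= n]; when [a] exceeds
    [n - k] the factor is 0. *)
Lemma avoid_prob_le n a k (rho : R) : (a <= n)%N -> (k <= n)%N -> (0 < n)%N ->
  1 - a%:R / n%:R <= rho -> avoid_prob n a k <= rho ^+ k.
Proof.
move=> an kn n0 rhoP; have N0 : 0 < n%:R :> R by rewrite ltr0n.
elim: k kn => [|k IH] kn; first by rewrite avoid_prob0.
rewrite avoid_probS // exprSr.
have nk0 : 0 < (n - k)%:R :> R by rewrite ltr0n subn_gt0.
apply: ler_pM => //; [exact: avoid_prob_ge0|exact/IH/ltnW|].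
apply: le_trans rhoP; rewrite ler_pdivrMr //.
have aN : a%:R / n%:R <= 1 :> R by rewrite ler_pdivrMr // mul1r ler_nat.
have [nka|ank] := leqP (n - k) a.
  by rewrite (eqP (nka : (n - k - a)%N == 0%N)) mulr_ge0 ?subr_ge0 // ltW.
rewrite natrB ?(ltnW ank) // mulrBl mul1r lerD2l lerN2 mulrAC ler_pdivrMr //.
by rewrite ler_wpM2l // ler_nat leq_subr.
Qed.

Lemma cvg_avoid_prob (a : nat -> nat) (d : R) (k : nat) :
  (forall n, a n <= n)%N -> (a n)%:R / n.+1%:R @[n --> \oo] --> d ->
  avoid_prob n (a n) k @[n --> \oo] --> (1 - d) ^+ k.
Proof.
move=> an ad; elim: k => [|k IH].
  by apply: cvg_near_cst; apply: nearW => n; rewrite avoid_prob0.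
(* Rewrites [n - k] as [(n + 1) * (1 - (k + 1) / (n + 1))] in the new factor [1 - a / (n - k)]. *)
apply: (@cvg_near_eq _ _ (fun n => avoid_prob n (a n) k *
    (1 - (a n)%:R / n.+1%:R / (1 - k.+1%:R * n.+1%:R^-1)))); last first.
  rewrite exprSr; apply: cvgM => //; apply: cvgB; first exact: cvg_cst.
  have -> : d = d / (1 - k.+1%:R * 0) by rewrite mulr0 subr0 divr1.
  apply: cvgM => //; apply: cvgV; first by rewrite mulr0 subr0 oner_eq0.
  by apply: cvgB; [apply: cvg_cst|apply: cvgMr; apply: cvg_invS].
near=> n.
have kn : (k < n)%N by near: n; apply: nbhs_infty_ge.
rewrite avoid_probS //; have nk0 : (n - k)%:R != 0 :> R.
  by rewrite pnatr_eq0 subn_eq0 -ltnNge.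
have [ank|nka] := leqP (a n) (n - k); last by rewrite /avoid_prob bin_small ?mul0r.
congr (_ * _); rewrite natrB //.
move: nk0; rewrite natrB ?(ltnW kn) // => nk0; field.
by rewrite opprD addrACA subrr add0r nk0 andbT addrC natr1 pnatr_eq0.
Unshelve. all: by end_near. Qed.

(** Exchanges the limits in [n] and [K]: for large [K], the three distances between [u n], [v n K],
    [S K] and [L] are at most [e / 3] for large [n]. *)
Lemma cvg_approx (u : nat -> R) (v : nat -> nat -> R) (S delta : nat -> R) (L : R) :
  (forall K, v n K @[n --> \oo] --> S K) ->
  (forall K, \forall n \near \oo, `|u n - v n K| <= delta K) ->
  S K @[K --> \oo] --> L -> delta K @[K --> \oo] --> (0 : R) ->
  u n @[n --> \oo] --> L.
Proof.
move=> vS uv SL delta0; apply/cvgrPdist_le => e e0.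
have e3 : 0 < e / 3 by rewrite divr_gt0.
have /(cvgrPdist_le _ _) /(_ _ e3) SLe := SL.
have /(cvgr0Pnorm_le _) /(_ _ e3) de := delta0.
have [K [SK dK]] : exists K, `|L - S K| <= e / 3 /\ `|delta K| <= e / 3.
  have : \forall K \near \oo, `|L - S K| <= e / 3 /\ `|delta K| <= e / 3.
    by near=> K; split; near: K.
  by move=> /filter_ex.
have /(cvgrPdist_le _ _) /(_ _ e3) vK := vS K.
near=> n.
have h1 : `|u n - v n K| <= delta K by near: n; apply: uv.
have h2 : `|S K - v n K| <= e / 3 by near: n.
have h3 := ler_norm (delta K).
have -> : L - u n = (L - S K) + (S K - v n K) - (u n - v n K) by ring.
apply: le_trans (ler_normB _ _) _; apply: le_trans (lerD (ler_normD _ _) (lexx _)) _.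
by lra.
Unshelve. all: by end_near. Qed.

(** * Monotonicity of [w * expR w] and Lambert's function *)

Lemma mul_expR_lt (v w : R) : -1 <= v -> v < w -> v * expR v < w * expR w.
Proof.
move=> v1 vw.
have -> : w * expR w = w * expR (w - v) * expR v by rewrite -mulrA -expRD subrK.
rewrite ltr_pM2r ?expR_gt0 //.
have [w0|w0] := leP 0 w.
  have h := expR_ge1Dx (w - v).
  by apply: (lt_le_trans vw); rewrite ler_peMr //; lra.
have h : 1 + (v - w) < expR (v - w) by apply: expR_gt1Dx; rewrite subr_eq0 lt_eqF.
have -> : expR (w - v) = (expR (v - w))^-1 by rewrite -expRN opprB.
rewrite ltr_pdivlMr ?expR_gt0 //.
(* As [v < 0], [h] gives [v * expR (v - w) < v + v * (v - w)], and this is at most [w] because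
   [(w - v) * (v + 1) >= 0]. *)
by nra.
Qed.

Lemma lambertW_mul_expR (v : R) : -1 <= v -> lambertW (v * expR v) = v.
Proof.
move=> v1; apply: xget_unique => // w [w1 e].
have [wv|vw|//] := ltgtP w v.
  by have := mul_expR_lt w1 wv; rewrite e ltxx.
by have := mul_expR_lt v1 vw; rewrite e ltxx.
Qed.

(** The function runs from 0 to [expR (-1)] on the unit interval; the strict bound on [x] excludes
    [w = 1]. *)
Lemma exists_mul_expRN (x : R) : 0 <= x -> x < expR (-1) ->
  exists w, [/\ 0 <= w, w < 1 & w * expR (- w) = x].
Proof.
move=> x0 x1; have [||w] := @IVT R (fun w => w * expR (- w)) 0 1 x ler01.
- apply: continuous_subspaceT => w; apply: cvgM; first exact: cvg_id.
  by apply: continuous_comp; [exact: opp_continuous|exact: continuous_expR].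
- by rewrite mul0r mul1r min_l ?max_r ?expR_ge0 // x0 ltW.
rewrite in_itv /= => /andP[w0 w1] wx; exists w; split => //.
rewrite lt_neqAle w1 andbT; apply/eqP => w1'.
by move: x1; rewrite -wx w1' mul1r ltxx.
Qed.

Lemma mul_expRN_le (d : R) : d * expR (- d) <= expR (-1).
Proof.
have := expR_ge1Dx (d - 1); rewrite addrC subrK expRD => h.
by rewrite expRN ler_pdivrMr ?expR_gt0 // mulrC.
Qed.

End Satisfiability.

(** * The limit of the probability of satisfiability *)

Lemma cvg_horn_sat_prob (R : realType) (d1 d2 w : R) :
  0 < d1 -> d1 < 1 -> 0 <= d2 -> 0 <= w -> w < 1 ->
  w * expR (- w) = (1 - d1) * (d2 * expR (- d2)) ->
  horn_sat_prob d1 d2 n @[n --> \oo] --> expR (- d2) * expR w.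
Proof.
move=> d1_gt0 d1_lt1 d2_ge0 w_ge0 w_lt1 we.
pose a n := Num.truncn (d1 * n.+1%:R); pose m n := Num.truncn (d2 * n.+1%:R).
have an n : (a n <= n)%N.
  by rewrite truncn_le_nat -[ltRHS]mul1r ltr_pM2r ?ltr0n.
(* Half of [d1] is given up to absorb the rounding in [a n]; [2 / d1 < n] makes this enough. *)
pose rho : R := 1 - d1 / 2.
have rho0 : 0 <= rho by rewrite /rho; lra.
have rho1 : rho < 1 by rewrite /rho; lra.
apply: (@cvg_approx _ _
  (fun n K => \sum_(k < K) ancestors_prob R n (m n) k * avoid_prob R n (a n) k)
  (fun K => \sum_(k < K)
    tree_coef R k * d2 ^+ k * expR (- (d2 * k.+1%:R)) * (1 - d1) ^+ k)
  (fun K => rho ^+ K)); last by apply: cvg_expr; rewrite ger0_norm.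
- move=> K; apply: (@cvg_ord_sum _ _
    (fun n k => ancestors_prob R n (m n) k * avoid_prob R n (a n) k)
    (fun k => tree_coef R k * d2 ^+ k * expR (- (d2 * k.+1%:R)) * (1 - d1) ^+ k)) => k.
  apply: cvgM; first exact/cvg_ancestors_prob/cvg_truncn.
  by apply: cvg_avoid_prob => //; apply/cvg_truncn/ltW.
- move=> K; near=> n.
  have n_gt0 : (0 < n)%N by near: n; apply: nbhs_infty_ge.
  have Kn : (K <= n)%N by near: n; apply: nbhs_infty_ge.
  have N0 : 0 < n%:R :> R by rewrite ltr0n.
  have dn : 2 / d1 < n%:R by near: n; apply: nbhs_infty_gtr.
  have rhoP : 1 - (a n)%:R / n%:R <= rho.
    rewrite lerD2l lerN2 ler_pdivlMr //.
    have : d1 * n.+1%:R < (a n).+1%:R by apply: truncnS_gt.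
    move: dn; rewrite ltr_pdivrMr // -[n.+1%:R]natr1 -[(a n).+1%:R]natr1.
    by lra.
  rewrite horn_sat_probE -/(a n) -/(m n).
  set f := fun k => ancestors_prob R n (m n) k * avoid_prob R n (a n) k.
  rewrite -(big_mkord xpredT f) -[X in _ - X](big_mkord xpredT f).
  rewrite (@big_cat_nat _ _ _ K) ?leqW //= addrC addrK ger0_norm; last first.
    by apply: sumr_ge0 => k _; rewrite mulr_ge0 ?ancestors_prob_ge0 ?avoid_prob_ge0.
  (* Beyond [K] every avoidance probability is at most [rho ^+ K], and the total mass is at most
     1. *)
  apply: (@le_trans _ _ (rho ^+ K * \sum_(K <= k < n.+1) ancestors_prob R n (m n) k)).
    rewrite mulr_sumr; apply: ler_sum_nat => k /andP[Kk kn].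
    rewrite /f [leLHS]mulrC ler_wpM2r ?ancestors_prob_ge0 //.
    apply: (@le_trans _ _ (rho ^+ k)); first exact: avoid_prob_le.
    by apply: ler_wiXn2l => //; apply: ltW.
  rewrite -[leRHS]mulr1 ler_wpM2l ?exprn_ge0 // -(sum_ancestors_prob R (m n) n_gt0).
  rewrite -(big_mkord xpredT (ancestors_prob R n (m n))).
  rewrite [leRHS](@big_cat_nat _ _ _ K) ?leqW //= lerDr.
  by apply: sumr_ge0 => k _; apply: ancestors_prob_ge0.
(* The series is evaluated at the density [w < 1], whatever the size of [d2]. *)
- apply: (@cvg_near_eq _ _ (fun K => expR (- d2) *
    \sum_(k < K) tree_coef R k * (w * expR (- w)) ^+ k)); last first.
    by apply: cvgMr; apply: cvg_tree_series.
  apply: nearW => K; rewrite mulr_sumr; apply: eq_bigr => k _.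
  rewrite we -[k.+1]addn1 natrD mulrDr mulr1 opprD expRD -mulNr expRM_natr !exprMn.
  by ring.
Unshelve. all: by end_near. Qed.

Theorem proposition1p2 (R : realType) (d1 d2 : R)
    (hd1 : 0 <= d1) (hd1lt : d1 < 1) (hd2 : 0 <= d2)
    (hdeg : d1 = 0 -> d2 <= 1) :
  horn_sat_prob d1 d2 n @[n --> \oo] --> Phi d1 d2.
Proof.
have [d1_0|d1_neq0] := eqVneq d1 0.
  have -> : Phi d1 d2 = 1.
    (* For [d2 <= 1], the point [- d2] lies on the principal branch, so the quotient is 1. *)
    rewrite /Phi; case: eqVneq => // d2_neq0.
    rewrite d1_0 subr0 mul1r -mulNr lambertW_mul_expR ?lerN2 ?hdeg //.
    by rewrite opprK divff.
  apply: cvg_near_cst; near=> n.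
  have n_gt0 : (0 < n)%N by near: n; apply: nbhs_infty_ge.
  rewrite horn_sat_probE d1_0 mul0r truncn0 -[RHS](sum_ancestors_prob R
    (Num.truncn (d2 * n.+1%:R)) n_gt0).
  by apply: eq_bigr => k _; rewrite /avoid_prob !bin0 divr1 mulr1.
have d1_gt0 : 0 < d1 by rewrite lt_neqAle eq_sym d1_neq0.
have s_gt0 : 0 < 1 - d1 by rewrite subr_gt0.
have [w [w_ge0 w_lt1 we]] : exists w : R, [/\ 0 <= w, w < 1 &
    w * expR (- w) = (1 - d1) * (d2 * expR (- d2))].
  apply: exists_mul_expRN.
    by rewrite !mulr_ge0 ?expR_ge0 // ltW.
  (* The factor [1 - d1 < 1] makes the bound strict, even at [d2 = 1]. *)
  apply: (@le_lt_trans _ _ ((1 - d1) * expR (-1))).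
    by rewrite ler_pM2l // mul_expRN_le.
  by rewrite gtr_pMl ?expR_gt0 // ltrBlDr ltrDl.
have -> : Phi d1 d2 = expR (- d2) * expR w.
  rewrite /Phi; case: eqVneq => [d2_0|d2_neq0].
    move/eqP: we; rewrite d2_0 mul0r mulr0 mulf_eq0 (gt_eqF (expR_gt0 _)) orbF.
    by move=> /eqP->; rewrite oppr0 expR0 mulr1.
  rewrite -mulrA -we -mulNr lambertW_mul_expR ?lerN2 ?ltW // opprK.
  have sd0 : (1 - d1) * d2 != 0 by rewrite mulf_neq0 // gt_eqF.
  (* Multiplying the equation for [w] by [expR w] gives [w = (1 - d1) * d2 * expR (w - d2)]. *)
  apply: (mulIf sd0); rewrite divfK //.
  have -> : expR (- d2) * expR w * ((1 - d1) * d2) =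
      (1 - d1) * (d2 * expR (- d2)) * expR w by ring.
  by rewrite -we -mulrA -expRD addNr expR0 mulr1.
exact: cvg_horn_sat_prob.
Unshelve. all: by end_near. Qed.
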